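(* Let $A$ be a monoid in a monoidal model category $\mathcal M$ for which the module category ${}_A\mathcal M$ is a closed model category with fibrations and weak equivalences created in $\mathcal M$. (a) $M$ is semicofibrant in ${}_A\mathcal M$ if and only if the functor $M\wedge(-)\colon\mathcal M\to{}_A\mathcal M$ preserves cofibrations and acyclic cofibrations. (b) If $M\in{}_A\mathcal M$ is cofibrant in ${}_A\mathcal M$ then it is semicofibrant in ${}_A\mathcal M$. Moreover, if the unit $I$ is cofibrant in $\mathcal M$, then an object $M$ of ${}_A\mathcal M$ is semicofibrant in ${}_A\mathcal M$ if and only if it is cofibrant in ${}_A\mathcal M$. (c) If $M\in{}_A\mathcal M$ is semicofibrant in ${}_A\mathcal M$ and $M\to N$ is a cofibration in ${}_A\mathcal M$, then $N$ is semicofibrant in ${}_A\mathcal M$. (d) $A$, considered as an object of ${}_A\mathcal M$, is semicofibrant in ${}_A\mathcal M$. In particular, $I$ is semicofibrant in $\mathcal M$.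
   Context: Monoidal model category: a closed model category $\mathcal M$ with a closed symmetric monoidal structure (product $\wedge$, unit $I$, internal function object $[-,-]$) such that: (Enr) if $g\colon K\to L$ is a cofibration and $h\colon X\to Y$ is a fibration, then the induced map $[L,X]\to[K,X]\times_{[K,Y]}[L,Y]$ is a fibration, and it is a weak equivalence if $g$ or $h$ is; (Unit) there exist a cofibrant object $I_c$ and a weak equivalence $\omega\colon I_c\to I$ such that $Z\cong[I,Z]\xrightarrow{\omega^*}[I_c,Z]$ is a weak equivalence for every fibrant $Z$. Modules: ${}_A\mathcal M$ is the category of left $A$-modules. For left $A$-modules $L,M$, the object ${}^A[L,M]$ of $\mathcal M$ is the equalizer of the two maps $[L,M]\rightrightarrows[A\wedge L,M]$, one induced by the action on $L$, the other the composite $[L,M]\to[A\wedge L,A\wedge M]\to[A\wedge L,M]$ using the action on $M$; this enriches ${}_A\mathcal M$ over $\mathcal M$. For $X$ in $\mathcal M$, $M\wedge X$ has the left $A$-action inherited from $M$. The model structure on ${}_A\mathcal M$ has fibrations and weak equivalences created in $\mathcal M$ if a map of ${}_A\mathcal M$ is a fibration (weak equivalence) exactly when its underlying map in $\mathcal M$ is. Semicofibrant: if $\mathcal C$ is a closed model category that is also enriched over $\mathcal M$ with mapping objects ${}^{\mathcal C}[-,-]$, an object $C$ is semicofibrant in $\mathcal C$ when ${}^{\mathcal C}[C,-]\colon\mathcal C\to\mathcal M$ preserves fibrations and acyclic fibrations. (Thus in ${}_A\mathcal M$ the functor in question is ${}^A[M,-]$, and in $\mathcal M$ it is $[X,-]$.)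 *)

(* Defs.v *)
From Stdlib Require Import List FinFun ProofIrrelevance ssreflect.

Set Implicit Arguments.
Unset Strict Implicit.
Unset Printing Implicit Defensive.

Record Category := MkCategory {
  Ob :> Type;
  hom : Ob -> Ob -> Type;
  idm : forall X, hom X X;
  comp : forall X Y Z, hom Y Z -> hom X Y -> hom X Z;
  comp1m : forall X Y (f : hom X Y), comp (idm Y) f = f;
  compm1 : forall X Y (f : hom X Y), comp f (idm X) = f;
  compA : forall W X Y Z (h : hom Y Z) (g : hom X Y) (f : hom W X),
    comp h (comp g f) = comp (comp h g) f }.

Arguments hom {_} _ _.
Arguments idm {_} _.
Arguments comp {_ _ _ _} _ _.

Declare Scope cat_scope.
Local Open Scope cat_scope.
Notation "g ∘ f" := (comp g f) (at level 40, left associativity) : cat_scope.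

Record Functor (C D : Category) := MkFunctor {
  fob :> C -> D;
  fmap : forall X Y : C, hom X Y -> hom (fob X) (fob Y);
  fmap1 : forall X : C, fmap (idm X) = idm (fob X);
  fmapM : forall (X Y Z : C) (g : hom Y Z) (f : hom X Y),
    fmap (g ∘ f) = fmap g ∘ fmap f }.

Arguments fmap {_ _} _ {_ _} _.

Record Cone (J C : Category) (F : Functor J C) := MkCone {
  cone_pt :> C;
  cone_leg : forall j : J, hom cone_pt (F j);
  cone_nat : forall (i j : J) (u : hom i j), fmap F u ∘ cone_leg i = cone_leg j }.

Record Limit (J C : Category) (F : Functor J C) := MkLimit {
  lim_cone :> Cone F;
  lim_lift : forall c : Cone F, hom c lim_cone;
  lim_liftE : forall (c : Cone F) (j : J),
    cone_leg lim_cone j ∘ lim_lift c = cone_leg c j;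
  lim_ext : forall (X : C) (f g : hom X lim_cone),
    (forall j, cone_leg lim_cone j ∘ f = cone_leg lim_cone j ∘ g) -> f = g }.

Record Cocone (J C : Category) (F : Functor J C) := MkCocone {
  cocone_pt :> C;
  cocone_leg : forall j : J, hom (F j) cocone_pt;
  cocone_nat : forall (i j : J) (u : hom i j),
    cocone_leg j ∘ fmap F u = cocone_leg i }.

Record Colimit (J C : Category) (F : Functor J C) := MkColimit {
  colim_cocone :> Cocone F;
  colim_desc : forall c : Cocone F, hom colim_cocone c;
  colim_descE : forall (c : Cocone F) (j : J),
    colim_desc c ∘ cocone_leg colim_cocone j = cocone_leg c j;
  colim_ext : forall (X : C) (f g : hom colim_cocone X),
    (forall j, f ∘ cocone_leg colim_cocone j = g ∘ cocone_leg colim_cocone j) ->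
    f = g }.

Definition finite_category (J : Category) : Prop :=
  Finite J /\ forall i j : J, Finite (hom i j).

(** Limits are chosen, so that equalizers and pullbacks are functions of the diagram. *)
Definition HasFiniteLimits (C : Category) : Type :=
  forall (J : Category) (F : Functor J C), finite_category J -> Limit F.

Definition HasFiniteColimits (C : Category) : Type :=
  forall (J : Category) (F : Functor J C), finite_category J -> Colimit F.

Definition empty_category : Category.
Proof.
by refine (@MkCategory Empty_set (fun _ _ => Empty_set)
  (fun e => match e with end) (fun e _ _ _ _ => match e with end) _ _ _); case.
Defined.

Definition empty_diagram (C : Category) : Functor empty_category C.
Proof.
by refine (@MkFunctor empty_category C (fun e => match e with end)
  (fun e _ _ => match e with end) _ _); case.
Defined.

Lemma empty_finite : finite_category empty_category.
Proof. by split; [exists nil; case | case]. Qed.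

Section InitialTerminal.
Context {C : Category} (lims : HasFiniteLimits C) (colims : HasFiniteColimits C).

Definition terminal : C := lims (empty_diagram C) empty_finite.

Definition to_terminal (X : C) : hom X terminal :=
  lim_lift _ (@MkCone _ _ (empty_diagram C) X
                (fun j => match j with end) (fun i => match i with end)).

Definition initial : C := colims (empty_diagram C) empty_finite.

Definition from_initial (X : C) : hom initial X :=
  colim_desc _ (@MkCocone _ _ (empty_diagram C) X
                  (fun j => match j with end) (fun i => match i with end)).
End InitialTerminal.

Inductive cospan_ob := cs_left | cs_right | cs_mid.

Definition cospan_hom (i j : cospan_ob) : Type :=
  match i, j with
  | cs_left, cs_left | cs_right, cs_right | cs_mid, cs_mid
  | cs_left, cs_mid | cs_right, cs_mid => unit
  | _, _ => Empty_set
  end.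

Definition cospan_category : Category.
Proof.
refine (@MkCategory cospan_ob cospan_hom
  (fun i => match i with cs_left | cs_right | cs_mid => tt end)
  (fun i j k => match i, j, k with
     | cs_left, cs_left, cs_left | cs_left, cs_left, cs_mid
     | cs_left, cs_mid, cs_mid | cs_right, cs_right, cs_right
     | cs_right, cs_right, cs_mid | cs_right, cs_mid, cs_mid
     | cs_mid, cs_mid, cs_mid => fun _ _ => tt
     | cs_left, cs_right, _ | cs_right, cs_left, _
     | cs_mid, cs_left, _ | cs_mid, cs_right, _ => fun _ e => match e with end
     | _, cs_left, cs_right | _, cs_right, cs_left
     | _, cs_mid, cs_left | _, cs_mid, cs_right => fun e _ => match e with end
     end) _ _ _).
- by case; case; case.
- by case; case; case.
- by case; case; case; case; (do !case).
Defined.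

Lemma cospan_finite : finite_category cospan_category.
Proof.
split; first by exists (cs_left :: cs_right :: cs_mid :: nil); case; simpl; auto.
case; case; solve [by exists nil; case | by exists (tt :: nil); case; left].
Qed.

Definition cospan_diagram (C : Category) (X Y Z : C) (f : hom X Z) (g : hom Y Z) :
  Functor cospan_category C.
Proof.
refine (@MkFunctor cospan_category C
  (fun i => match i with cs_left => X | cs_right => Y | cs_mid => Z end)
  (fun i j => match i, j with
     | cs_left, cs_left => fun _ => idm X
     | cs_right, cs_right => fun _ => idm Y
     | cs_mid, cs_mid => fun _ => idm Z
     | cs_left, cs_mid => fun _ => f
     | cs_right, cs_mid => fun _ => g
     | _, _ => fun e => match e with end
     end) _ _).
- by case.
- by case; case; case; case; case; rewrite /= ?comp1m ?compm1.
Defined.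

Section Pullback.
Context {C : Category} (lims : HasFiniteLimits C).
Context {X Y Z : C} (f : hom X Z) (g : hom Y Z).

Definition pullback_limit : Limit (cospan_diagram f g) :=
  lims (cospan_diagram f g) cospan_finite.

Definition pullback : C := pullback_limit.

Definition pb1 : hom pullback X := cone_leg pullback_limit cs_left.
Definition pb2 : hom pullback Y := cone_leg pullback_limit cs_right.

Definition cospan_cone (W : C) (u : hom W X) (v : hom W Y) (e : f ∘ u = g ∘ v) :
  Cone (cospan_diagram f g).
Proof.
refine (@MkCone _ _ (cospan_diagram f g) W
  (fun j => match j with cs_left => u | cs_right => v | cs_mid => f ∘ u end) _).
by case; case; case; rewrite /= ?comp1m.
Defined.

Definition pb_pair (W : C) (u : hom W X) (v : hom W Y) (e : f ∘ u = g ∘ v) :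
  hom W pullback := lim_lift pullback_limit (cospan_cone e).
End Pullback.

Inductive ppair_ob := pp_src | pp_tgt.

Definition ppair_hom (i j : ppair_ob) : Type :=
  match i, j with
  | pp_src, pp_tgt => bool
  | pp_tgt, pp_src => Empty_set
  | _, _ => unit
  end.

Definition ppair_category : Category.
Proof.
refine (@MkCategory ppair_ob ppair_hom
  (fun i => match i with pp_src | pp_tgt => tt end)
  (fun i j k => match i, j, k with
     | pp_src, pp_src, pp_src | pp_tgt, pp_tgt, pp_tgt => fun _ _ => tt
     | pp_src, pp_src, pp_tgt => fun b _ => b
     | pp_src, pp_tgt, pp_tgt => fun _ b => b
     | pp_tgt, pp_src, _ => fun _ e => match e with end
     | _, pp_tgt, pp_src => fun e _ => match e with end
     end) _ _ _).
- by case; case; case.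
- by case; case; case.
- by case; case; case; case; (do !case).
Defined.

Lemma ppair_finite : finite_category ppair_category.
Proof.
split; first by exists (pp_src :: pp_tgt :: nil); case; simpl; auto.
case; case; solve [by exists nil; case | by exists (tt :: nil); case; left
  | by exists (true :: false :: nil); case; simpl; auto].
Qed.

Definition ppair_diagram (C : Category) (X Y : C) (f g : hom X Y) :
  Functor ppair_category C.
Proof.
refine (@MkFunctor ppair_category C
  (fun i => match i with pp_src => X | pp_tgt => Y end)
  (fun i j => match i, j with
     | pp_src, pp_src => fun _ => idm X
     | pp_tgt, pp_tgt => fun _ => idm Y
     | pp_src, pp_tgt => fun b : bool => if b then f else g
     | pp_tgt, pp_src => fun e => match e with end
     end) _ _).
- by case.
- by case; case; case; case; case; rewrite /= ?comp1m ?compm1.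
Defined.

Section Equalizer.
Context {C : Category} (lims : HasFiniteLimits C) {X Y : C} (f g : hom X Y).

Definition equalizer_limit : Limit (ppair_diagram f g) :=
  lims (ppair_diagram f g) ppair_finite.

Definition equalizer : C := equalizer_limit.

Definition eq_incl : hom equalizer X := cone_leg equalizer_limit pp_src.

Lemma eq_inclE : f ∘ eq_incl = g ∘ eq_incl.
Proof.
have e := fun b => @cone_nat _ _ _ equalizer_limit pp_src pp_tgt b.
by rewrite -[f]/(fmap (ppair_diagram f g) (true : @hom ppair_category pp_src pp_tgt))
  -[g in RHS]/(fmap (ppair_diagram f g) (false : @hom ppair_category pp_src pp_tgt)) !e.
Qed.

Definition ppair_cone (W : C) (u : hom W X) (e : f ∘ u = g ∘ u) :
  Cone (ppair_diagram f g).
Proof.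
refine (@MkCone _ _ (ppair_diagram f g) W
  (fun j => match j with pp_src => u | pp_tgt => f ∘ u end) _).
by case; case; case; rewrite /= ?comp1m.
Defined.

Definition eq_lift (W : C) (u : hom W X) (e : f ∘ u = g ∘ u) : hom W equalizer :=
  lim_lift equalizer_limit (ppair_cone e).

Lemma eq_liftE (W : C) (u : hom W X) (e : f ∘ u = g ∘ u) : eq_incl ∘ eq_lift e = u.
Proof. exact: (lim_liftE equalizer_limit (ppair_cone e) pp_src). Qed.

Lemma eq_ext (W : C) (u v : hom W equalizer) : eq_incl ∘ u = eq_incl ∘ v -> u = v.
Proof.
move=> e; apply: lim_ext; case; first exact: e.
rewrite -(@cone_nat _ _ _ equalizer_limit pp_src pp_tgt true) -!compA.
by congr (_ ∘ _).
Qed.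
End Equalizer.

Definition MorClass (C : Category) := forall X Y : C, hom X Y -> Prop.

Definition is_retract (C : Category) (X Y X' Y' : C) (f : hom X Y) (g : hom X' Y') :
  Prop :=
  exists (i : hom X X') (r : hom X' X) (j : hom Y Y') (s : hom Y' Y),
    r ∘ i = idm X /\ s ∘ j = idm Y /\ g ∘ i = j ∘ f /\ f ∘ r = s ∘ g.

Definition retract_closed (C : Category) (P : MorClass C) : Prop :=
  forall (X Y X' Y' : C) (f : hom X Y) (g : hom X' Y'),
    is_retract f g -> P _ _ g -> P _ _ f.

Definition has_lift (C : Category) (K L X Y : C) (i : hom K L) (p : hom X Y) : Prop :=
  forall (u : hom K X) (v : hom L Y), p ∘ u = v ∘ i ->
    exists h : hom L X, h ∘ i = u /\ p ∘ h = v.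

(** Quillen's axioms CM1-CM5.  Only finite limits and colimits are required,
    and the factorizations are not required to be functorial. *)
Record ModelStructure (C : Category) := MkModelStructure {
  weq : MorClass C;
  fib : MorClass C;
  cof : MorClass C;
  lims : HasFiniteLimits C;
  colims : HasFiniteColimits C;
  weq_comp : forall (X Y Z : C) (g : hom Y Z) (f : hom X Y),
    weq f -> weq g -> weq (g ∘ f);
  weq_cancel_l : forall (X Y Z : C) (g : hom Y Z) (f : hom X Y),
    weq g -> weq (g ∘ f) -> weq f;
  weq_cancel_r : forall (X Y Z : C) (g : hom Y Z) (f : hom X Y),
    weq f -> weq (g ∘ f) -> weq g;
  weq_retract : retract_closed weq;
  fib_retract : retract_closed fib;
  cof_retract : retract_closed cof;
  lift_cof_afib : forall (K L X Y : C) (i : hom K L) (p : hom X Y),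
    cof i -> fib p -> weq p -> has_lift i p;
  lift_acof_fib : forall (K L X Y : C) (i : hom K L) (p : hom X Y),
    cof i -> weq i -> fib p -> has_lift i p;
  factor_cof_afib : forall (X Y : C) (f : hom X Y),
    exists (Z : C) (i : hom X Z) (p : hom Z Y),
      cof i /\ fib p /\ weq p /\ f = p ∘ i;
  factor_acof_fib : forall (X Y : C) (f : hom X Y),
    exists (Z : C) (i : hom X Z) (p : hom Z Y),
      cof i /\ weq i /\ fib p /\ f = p ∘ i }.

Arguments weq {_} _ {_ _} _.
Arguments fib {_} _ {_ _} _.
Arguments cof {_} _ {_ _} _.

Section ModelNotions.
Context {C : Category} (Q : ModelStructure C).

Definition afib {X Y : C} (f : hom X Y) : Prop := fib Q f /\ weq Q f.
Definition acof {X Y : C} (f : hom X Y) : Prop := cof Q f /\ weq Q f.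

Definition cofibrant (X : C) : Prop := cof Q (from_initial (colims Q) X).
Definition fibrant (X : C) : Prop := fib Q (to_terminal (lims Q) X).
End ModelNotions.

Section Preservation.
Context {C D : Category} (QC : ModelStructure C) (QD : ModelStructure D).
Variable F : Functor C D.

Definition preserves_fibrations : Prop :=
  forall (X Y : C) (f : hom X Y), fib QC f -> fib QD (fmap F f).
Definition preserves_acyclic_fibrations : Prop :=
  forall (X Y : C) (f : hom X Y), afib QC f -> afib QD (fmap F f).
Definition preserves_cofibrations : Prop :=
  forall (X Y : C) (f : hom X Y), cof QC f -> cof QD (fmap F f).
Definition preserves_acyclic_cofibrations : Prop :=
  forall (X Y : C) (f : hom X Y), acof QC f -> acof QD (fmap F f).
End Preservation.

(** [map_from X] stands for the functor [^C[X,-]] of mapping objects of an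
    enrichment of [C] over [V]; this is all of the enrichment that matters here. *)
Definition semicofibrant (C V : Category) (QC : ModelStructure C)
  (QV : ModelStructure V) (map_from : C -> Functor C V) (X : C) : Prop :=
  preserves_fibrations QC QV (map_from X) /\
  preserves_acyclic_fibrations QC QV (map_from X).

(** [tens] is the product written [∧] on paper; [ihom X -] is right adjoint to [- ∧ X]. *)
Record ClosedSymMon (C : Category) := MkClosedSymMon {
  tens : C -> C -> C;
  tmap : forall X X' Y Y' : C,
    hom X X' -> hom Y Y' -> hom (tens X Y) (tens X' Y');
  tmap1 : forall X Y : C, tmap (idm X) (idm Y) = idm (tens X Y);
  tmapM : forall (X X' X'' Y Y' Y'' : C) (f' : hom X' X'') (f : hom X X')
    (g' : hom Y' Y'') (g : hom Y Y'),
    tmap (f' ∘ f) (g' ∘ g) = tmap f' g' ∘ tmap f g;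
  unit_ob : C;

  assoc : forall X Y Z : C, hom (tens (tens X Y) Z) (tens X (tens Y Z));
  assocV : forall X Y Z : C, hom (tens X (tens Y Z)) (tens (tens X Y) Z);
  assocK : forall X Y Z : C, assocV X Y Z ∘ assoc X Y Z = idm _;
  assocVK : forall X Y Z : C, assoc X Y Z ∘ assocV X Y Z = idm _;
  assoc_nat : forall (X X' Y Y' Z Z' : C) (f : hom X X') (g : hom Y Y') (h : hom Z Z'),
    assoc X' Y' Z' ∘ tmap (tmap f g) h = tmap f (tmap g h) ∘ assoc X Y Z;

  lunit : forall X : C, hom (tens unit_ob X) X;
  lunitV : forall X : C, hom X (tens unit_ob X);
  lunitK : forall X : C, lunitV X ∘ lunit X = idm _;
  lunitVK : forall X : C, lunit X ∘ lunitV X = idm _;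
  lunit_nat : forall (X X' : C) (f : hom X X'),
    lunit X' ∘ tmap (idm unit_ob) f = f ∘ lunit X;

  runit : forall X : C, hom (tens X unit_ob) X;
  runitV : forall X : C, hom X (tens X unit_ob);
  runitK : forall X : C, runitV X ∘ runit X = idm _;
  runitVK : forall X : C, runit X ∘ runitV X = idm _;
  runit_nat : forall (X X' : C) (f : hom X X'),
    runit X' ∘ tmap f (idm unit_ob) = f ∘ runit X;

  braid : forall X Y : C, hom (tens X Y) (tens Y X);
  braidK : forall X Y : C, braid Y X ∘ braid X Y = idm _;
  braid_nat : forall (X X' Y Y' : C) (f : hom X X') (g : hom Y Y'),
    braid X' Y' ∘ tmap f g = tmap g f ∘ braid X Y;

  triangle : forall X Y : C,
    tmap (idm X) (lunit Y) ∘ assoc X unit_ob Y = tmap (runit X) (idm Y);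
  pentagon : forall W X Y Z : C,
    assoc W X (tens Y Z) ∘ assoc (tens W X) Y Z =
    tmap (idm W) (assoc X Y Z) ∘ assoc W (tens X Y) Z ∘ tmap (assoc W X Y) (idm Z);
  hexagon : forall X Y Z : C,
    assoc Y Z X ∘ braid X (tens Y Z) ∘ assoc X Y Z =
    tmap (idm Y) (braid X Z) ∘ assoc Y X Z ∘ tmap (braid X Y) (idm Z);

  ihom : C -> C -> C;
  ev : forall X Y : C, hom (tens (ihom X Y) X) Y;
  curry : forall X Y Z : C, hom (tens Z X) Y -> hom Z (ihom X Y);
  curryK : forall (X Y Z : C) (f : hom (tens Z X) Y),
    ev X Y ∘ tmap (curry f) (idm X) = f;
  curry_uniq : forall (X Y Z : C) (k : hom Z (ihom X Y)),
    curry (ev X Y ∘ tmap k (idm X)) = k }.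

Arguments tens {_} _ _ _.
Arguments tmap {_} _ {_ _ _ _} _ _.
Arguments unit_ob {_} _.
Arguments assoc {_} _ _ _ _.
Arguments assocV {_} _ _ _ _.
Arguments lunit {_} _ _.
Arguments lunitV {_} _ _.
Arguments runit {_} _ _.
Arguments runitV {_} _ _.
Arguments braid {_} _ _ _.
Arguments ihom {_} _ _ _.
Arguments ev {_} _ _ _.
Arguments curry {_} _ {_ _ _} _.

Section ClosedSymMonTheory.
Context {C : Category} (S : ClosedSymMon C).
Local Notation "X ⊗ Y" := (tens S X Y) (at level 38, left associativity).
Local Notation "f ⊠ g" := (tmap S f g) (at level 38, left associativity).
Local Notation "1" := (idm _).
Local Notation I := (unit_ob S).

Lemma tmap_l {X X' X'' Y Y' : C} (f' : hom X' X'') (f : hom X X') (g : hom Y Y') :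
  (f' ∘ f) ⊠ g = (f' ⊠ 1) ∘ (f ⊠ g).
Proof. by rewrite -tmapM comp1m. Qed.

Lemma tmap_r {X X' Y Y' Y'' : C} (f : hom X X') (g' : hom Y' Y'') (g : hom Y Y') :
  f ⊠ (g' ∘ g) = (1 ⊠ g') ∘ (f ⊠ g).
Proof. by rewrite -tmapM comp1m. Qed.

Lemma tmap_swap {X X' Y Y' : C} (f : hom X X') (g : hom Y Y') :
  (f ⊠ 1) ∘ (1 ⊠ g) = (1 ⊠ g) ∘ (f ⊠ 1).
Proof. by rewrite -!tmapM !comp1m !compm1. Qed.

Lemma cancel_epi {X Y Z : C} (e : hom X Y) (e' : hom Y X) (f g : hom Y Z) :
  e ∘ e' = 1 -> f ∘ e = g ∘ e -> f = g.
Proof. by move=> ee' /(f_equal (fun h => h ∘ e')); rewrite -!compA ee' !compm1. Qed.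

Lemma cancel_mono {X Y Z : C} (m : hom Y Z) (m' : hom Z Y) (f g : hom X Y) :
  m' ∘ m = 1 -> m ∘ f = m ∘ g -> f = g.
Proof. by move=> mm' /(f_equal (fun h => m' ∘ h)); rewrite !compA mm' !comp1m. Qed.

Lemma assocV_nat {X X' Y Y' Z Z' : C} (f : hom X X') (g : hom Y Y') (h : hom Z Z') :
  assocV S X' Y' Z' ∘ (f ⊠ (g ⊠ h)) = (f ⊠ g) ⊠ h ∘ assocV S X Y Z.
Proof.
apply: (cancel_mono (assocK S X' Y' Z')).
by rewrite !compA assocVK comp1m assoc_nat -compA assocVK compm1.
Qed.

Lemma tens_unit_faithful {X Y : C} (f g : hom X Y) :
  idm I ⊠ f = idm I ⊠ g -> f = g.
Proof.
move=> /(f_equal (fun h => lunit S Y ∘ h)); rewrite !lunit_nat.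
exact: (cancel_epi (lunitVK S X)).
Qed.

Lemma lunit_assoc (X Y : C) : lunit S (X ⊗ Y) ∘ assoc S I X Y = lunit S X ⊠ 1.
Proof.
apply: tens_unit_faithful.
apply: (@cancel_epi _ _ _ (assoc S I (I ⊗ X) Y) (assocV S _ _ _)); first exact: assocVK.
apply: (@cancel_epi _ _ _ (assoc S I I X ⊠ idm Y) (assocV S I I X ⊠ idm Y)).
  by rewrite -tmap_l assocVK tmap1.
rewrite tmap_r -!compA (compA (1 ⊠ assoc S I X Y)) -pentagon.
rewrite compA triangle -[idm (X ⊗ Y)]tmap1 -assoc_nat.
by rewrite compA -assoc_nat -compA -tmap_l triangle.
Qed.

Lemma lunit_assocV (X Y : C) : (lunit S X ⊠ 1) ∘ assocV S I X Y = lunit S (X ⊗ Y).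
Proof. by rewrite -lunit_assoc -compA assocVK compm1. Qed.

Lemma pentagonV (W X Y Z : C) :
  assocV S W (X ⊗ Y) Z ∘ (1 ⊠ assocV S X Y Z) ∘ assoc S W X (Y ⊗ Z) =
  (assoc S W X Y ⊠ 1) ∘ assocV S (W ⊗ X) Y Z.
Proof.
apply: (cancel_epi (assocVK S (W ⊗ X) Y Z)).
rewrite -!compA assocK compm1 pentagon -!compA (compA (1 ⊠ assocV S X Y Z)).
by rewrite -tmap_r assocK tmap1 comp1m compA assocK comp1m.
Qed.

(** [[L,f]]. *)
Definition ihom_map {L X Y : C} (f : hom X Y) : hom (ihom S L X) (ihom S L Y) :=
  curry S (f ∘ ev S L X).

(** [[g,X]]. *)
Definition ihom_pre {K L : C} (g : hom K L) (X : C) : hom (ihom S L X) (ihom S K X) :=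
  curry S (ev S L X ∘ (1 ⊠ g)).

Lemma ev_map {L X Y : C} (f : hom X Y) :
  ev S L Y ∘ (ihom_map f ⊠ 1) = f ∘ ev S L X.
Proof. exact: curryK. Qed.

Lemma ev_pre {K L : C} (g : hom K L) (X : C) :
  ev S K X ∘ (ihom_pre g X ⊠ 1) = ev S L X ∘ (1 ⊠ g).
Proof. exact: curryK. Qed.

Lemma ihom_ext {L X Z : C} (k k' : hom Z (ihom S L X)) :
  ev S L X ∘ (k ⊠ 1) = ev S L X ∘ (k' ⊠ 1) -> k = k'.
Proof. by move=> e; rewrite -(curry_uniq k) e curry_uniq. Qed.

Lemma ihom_map1 (L X : C) : ihom_map (idm X) = idm (ihom S L X).
Proof. by apply: ihom_ext; rewrite ev_map comp1m tmap1 compm1. Qed.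

Lemma ihom_mapM {L X Y Z : C} (g : hom Y Z) (f : hom X Y) :
  ihom_map (L := L) (g ∘ f) = ihom_map g ∘ ihom_map f.
Proof. by apply: ihom_ext; rewrite tmap_l compA !ev_map -!compA ev_map. Qed.

Definition ihom_functor (L : C) : Functor C C :=
  MkFunctor (ihom_map1 L) (@ihom_mapM L).

Lemma ihom_pre_map {K L X Y : C} (g : hom K L) (f : hom X Y) :
  ihom_pre g Y ∘ ihom_map f = ihom_map f ∘ ihom_pre g X.
Proof.
apply: ihom_ext.
rewrite !tmap_l !compA ev_pre ev_map -compA -tmap_swap compA ev_map.
by rewrite -!compA ev_pre.
Qed.

(** The map [[L,X] -> [A∧L, A∧X]] induced by the functor [A∧-]: the transpose of
    [[L,X]∧(A∧L) ≅ A∧([L,X]∧L) -> A∧X]. *)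
Definition ihom_smash (A L X : C) : hom (ihom S L X) (ihom S (A ⊗ L) (A ⊗ X)) :=
  curry S ((1 ⊠ ev S L X) ∘ assoc S A (ihom S L X) L
           ∘ (braid S (ihom S L X) A ⊠ 1) ∘ assocV S (ihom S L X) A L).

Lemma ihom_smash_map (A : C) {L X Y : C} (f : hom X Y) :
  ihom_smash A L Y ∘ ihom_map f = ihom_map (1 ⊠ f) ∘ ihom_smash A L X.
Proof.
apply: ihom_ext; rewrite [in RHS]tmap_l compA ev_map -compA !curryK.
rewrite tmap_l compA curryK -[idm (A ⊗ L)]tmap1.
rewrite -[_ ∘ assocV S (ihom S L Y) A L ∘ _]compA assocV_nat.
rewrite !compA -[_ ∘ (braid S (ihom S L Y) A ⊠ 1) ∘ _]compA -tmap_l braid_nat tmap_l.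
rewrite !compA -[_ ∘ assoc S A (ihom S L Y) L ∘ _]compA assoc_nat.
by rewrite !compA -tmap_r ev_map tmap_r.
Qed.
End ClosedSymMonTheory.

Arguments ihom_map {_} _ _ {_ _} _.

(** The map [[L,X] -> [K,X] ×_[K,Y] [L,Y]] induced by [g : K -> L] and [h : X -> Y]. *)
Definition pullback_hom (C : Category) (lim : HasFiniteLimits C) (S : ClosedSymMon C)
  (K L X Y : C) (g : hom K L) (h : hom X Y) :
  hom (ihom S L X) (pullback lim (ihom_map S K h) (ihom_pre S g Y)) :=
  pb_pair lim (eq_sym (ihom_pre_map S g h)).

(** In [mm_unit], [curry (runit Z)] is the isomorphism [Z ≅ [I,Z]]. *)
Record MonoidalModelCategory := MkMonoidalModelCategory {
  mm_cat :> Category;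
  mm_model : ModelStructure mm_cat;
  mm_mon : ClosedSymMon mm_cat;
  mm_enr : forall (K L X Y : mm_cat) (g : hom K L) (h : hom X Y),
    cof mm_model g -> fib mm_model h ->
    fib mm_model (pullback_hom (lims mm_model) mm_mon g h) /\
    (weq mm_model g \/ weq mm_model h ->
     weq mm_model (pullback_hom (lims mm_model) mm_mon g h));
  mm_unit : exists (Ic : mm_cat) (w : hom Ic (unit_ob mm_mon)),
    cofibrant mm_model Ic /\ weq mm_model w /\
    forall Z : mm_cat, fibrant mm_model Z ->
      weq mm_model (ihom_pre mm_mon w Z ∘ curry mm_mon (runit mm_mon Z)) }.

Record Monoid (C : Category) (S : ClosedSymMon C) := MkMonoid {
  mon_ob :> C;
  mon_mul : hom (tens S mon_ob mon_ob) mon_ob;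
  mon_one : hom (unit_ob S) mon_ob;
  mon_mulA : mon_mul ∘ tmap S (idm mon_ob) mon_mul ∘ assoc S mon_ob mon_ob mon_ob =
    mon_mul ∘ tmap S mon_mul (idm mon_ob);
  mon_mul1l : mon_mul ∘ tmap S mon_one (idm mon_ob) = lunit S mon_ob;
  mon_mul1r : mon_mul ∘ tmap S (idm mon_ob) mon_one = runit S mon_ob }.

Section Modules.
Context {C : Category} {S : ClosedSymMon C} (A : Monoid S).
Local Notation "X ⊗ Y" := (tens S X Y) (at level 38, left associativity).
Local Notation "f ⊠ g" := (tmap S f g) (at level 38, left associativity).
Local Notation "1" := (idm _).

Record LModule := MkLModule {
  mod_ob :> C;
  act : hom (A ⊗ mod_ob) mod_ob;
  act_mul : act ∘ (1 ⊠ act) ∘ assoc S A A mod_ob = act ∘ (mon_mul A ⊠ 1);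
  act_one : act ∘ (mon_one A ⊠ 1) = lunit S mod_ob }.

Definition is_module_map (M N : LModule) (f : hom M N) : Prop :=
  f ∘ act M = act N ∘ (1 ⊠ f).

Definition ModHom (M N : LModule) : Type := {f : hom M N | is_module_map f}.

Lemma modhom_ext {M N : LModule} (f g : ModHom M N) : proj1_sig f = proj1_sig g -> f = g.
Proof.
move: f g => [f pf] [g pg] /= e; subst g.
by rewrite (proof_irrelevance _ pf pg).
Qed.

Definition mod_id (M : LModule) : ModHom M M.
Proof. by exists 1; rewrite /is_module_map comp1m tmap1 compm1. Defined.

Definition mod_comp (M N P : LModule) (g : ModHom N P) (f : ModHom M N) : ModHom M P.
Proof.
exists (proj1_sig g ∘ proj1_sig f); move: f g => [f pf] [g pg] /=.
by rewrite /is_module_map -compA pf compA pg -compA -tmap_r.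
Defined.

Definition Mod : Category.
Proof.
refine (@MkCategory LModule ModHom mod_id mod_comp _ _ _).
- by move=> X Y f; apply: modhom_ext; rewrite /= comp1m.
- by move=> X Y f; apply: modhom_ext; rewrite /= compm1.
- by move=> W X Y Z h g f; apply: modhom_ext; rewrite /= compA.
Defined.

Definition underlying : Functor Mod C.
Proof. by refine (@MkFunctor Mod C mod_ob (fun M N f => proj1_sig f) _ _). Defined.

Definition regular_module : Mod := MkLModule (mon_mulA A) (mon_mul1l A).

(** [M∧X], with the action [A∧(M∧X) ≅ (A∧M)∧X -> M∧X]. *)
Definition smash_module (M : Mod) (X : C) : Mod.
Proof.
refine (@MkLModule (mod_ob M ⊗ X) ((act M ⊠ 1) ∘ assocV S A M X) _ _).
- rewrite tmap_r -!compA (compA (assocV S A (mod_ob M) X)) assocV_nat.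
  rewrite -!compA (compA (assocV S A _ X)) pentagonV.
  rewrite !compA -!tmap_l act_mul -[RHS]compA -[idm (mod_ob M ⊗ X)]tmap1.
  by rewrite assocV_nat compA -tmap_l.
- by rewrite -compA -tmap1 assocV_nat compA -tmap_l act_one lunit_assocV.
Defined.

Definition smash_map (M : Mod) (X Y : C) (f : hom X Y) :
  hom (smash_module M X) (smash_module M Y).
Proof.
exists (idm (mod_ob M) ⊠ f); rewrite /is_module_map /= -[RHS]compA assocV_nat.
by rewrite tmap1 !compA tmap_swap.
Defined.

Definition smash_functor (M : Mod) : Functor C Mod.
Proof.
refine (@MkFunctor C Mod (smash_module M) (@smash_map M) _ _).
- by move=> X; apply: modhom_ext; rewrite /= tmap1.
- by move=> X Y Z g f; apply: modhom_ext; rewrite /= tmap_r.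
Defined.

Section MappingObjects.
Variable lim : HasFiniteLimits C.
Local Notation "[ X , Y ]" := (ihom S X Y).

(** The two maps [[L,M] -> [A∧L,M]], induced by the actions on [L] and on [M]. *)
Definition map_source (L M : Mod) : hom [mod_ob L, mod_ob M] [A ⊗ mod_ob L, mod_ob M] :=
  ihom_pre S (act L) (mod_ob M).

Definition map_target (L M : Mod) : hom [mod_ob L, mod_ob M] [A ⊗ mod_ob L, mod_ob M] :=
  ihom_map S (A ⊗ mod_ob L) (act M) ∘ ihom_smash S A (mod_ob L) (mod_ob M).

Definition map_ob (L M : Mod) : C := equalizer lim (map_source L M) (map_target L M).

Definition map_incl (L M : Mod) : hom (map_ob L M) [mod_ob L, mod_ob M] :=
  eq_incl lim (map_source L M) (map_target L M).

Lemma map_mor_compat (L M N : Mod) (f : hom M N) :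
  map_source L N ∘ (ihom_map S (mod_ob L) (proj1_sig f) ∘ map_incl L M) =
  map_target L N ∘ (ihom_map S (mod_ob L) (proj1_sig f) ∘ map_incl L M).
Proof.
rewrite !compA ihom_pre_map -compA eq_inclE /map_target -!compA.
rewrite (compA (ihom_smash _ _ _ _)) ihom_smash_map !compA -!ihom_mapM.
by rewrite (proj2_sig f).
Qed.

(** [^A[L,f]], induced on equalizers by [[L,f]]. *)
Definition map_mor (L M N : Mod) (f : hom M N) : hom (map_ob L M) (map_ob L N) :=
  eq_lift lim (map_mor_compat L f).

Lemma map_morE (L M N : Mod) (f : hom M N) :
  map_incl L N ∘ map_mor L f = ihom_map S (mod_ob L) (proj1_sig f) ∘ map_incl L M.
Proof. exact: eq_liftE. Qed.

Definition map_functor (L : Mod) : Functor Mod C.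
Proof.
refine (@MkFunctor Mod C (map_ob L) (@map_mor L) _ _).
- by move=> M; apply: eq_ext; rewrite [LHS]map_morE /= ihom_map1 comp1m compm1.
- move=> M N P g f; apply: eq_ext; rewrite [LHS]map_morE /= ihom_mapM.
  by rewrite compA [in RHS]map_morE -!compA map_morE.
Defined.
End MappingObjects.
End Modules.

Arguments Mod {_ _} _.
Arguments underlying {_ _} _.
Arguments regular_module {_ _} _.

Definition created (C : Category) (S : ClosedSymMon C) (A : Monoid S)
  (Q : ModelStructure C) (QA : ModelStructure (Mod A)) : Prop :=
  forall (M N : Mod A) (f : hom M N),
    (fib QA f <-> fib Q (fmap (underlying A) f)) /\
    (weq QA f <-> weq Q (fmap (underlying A) f)).

Section Semicofibrant.
Variable V : MonoidalModelCategory.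

Definition semicofibrant_ob (X : V) : Prop :=
  semicofibrant (mm_model V) (mm_model V) (ihom_functor (mm_mon V)) X.

Definition semicofibrant_mod (A : Monoid (mm_mon V)) (QA : ModelStructure (Mod A))
  (M : Mod A) : Prop :=
  semicofibrant QA (mm_model V) (map_functor (lims (mm_model V))) M.
End Semicofibrant.

(* Main.v *)
From Stdlib Require Import ssreflect.
Require Import Defs.

Set Implicit Arguments.
Unset Strict Implicit.
Unset Printing Implicit Defensive.

Local Open Scope cat_scope.

(** Two adjunctions govern the modules.  Let [V] be the monoidal model category.
    For modules [M] and [N], a map [f : M ∧ X -> N] in [V] that is linear in [M]
    ([act_linear]) is the same thing as
    - an [A]-module map [M ∧ X -> N];
    - a map [X -> ^A[M,N]] in [V], by transposing [f] composed with the symmetry;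
    - an [A]-module map [M -> [X,N]], where [[X,N]] is the cotensor, that is, the
      internal function object with the action inherited from [N].

    The first two make [M ∧ -] left adjoint to [^A[M,-]] ([smash_map_adjunction]).
    In a model category the cofibrations and the acyclic fibrations determine each
    other by lifting, as do the acyclic cofibrations and the fibrations, so
    [^A[M,-]] preserves fibrations and acyclic fibrations exactly when [M ∧ -]
    preserves acyclic cofibrations and cofibrations; this is (a).

    For (c), let [i : M -> N] be a cofibration of modules, [j : U -> W] a cofibration
    and [p : X -> Y] a fibration of modules, one of [j] and [p] being acyclic.
    By (a), what is wanted is a lift in a square from [N ∧ j] to [p].  A lift exists
    after restriction along [i], since [M] is semicofibrant.  Transposed to the
    cotensor, extending it over [N] is a lifting problem for [i] against
    [[W,X] -> [U,X] ×_[U,Y] [W,Y]].  This is a map of modules whose underlying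
    map is an acyclic fibration by the enrichment axiom, and acyclic fibrations are
    created in [V], so the lift exists ([smash_lift_extend]).

    The first half of (b) is the same argument for [i : 0 -> M], because maps out of
    [0 ∧ X] are unique and lifts from [0 ∧ j] therefore always exist.
    Conversely, if [I] is cofibrant and [M] semicofibrant, then [M ∧ -] turns [0 -> I]
    into a cofibration, of which [0 -> M] is a retract as [M ∧ I ≅ M] and [M ∧ 0] is
    initial.

    For (d), [A ∧ -] is also left adjoint to the forgetful functor
    ([free_adjunction]), which preserves fibrations and acyclic fibrations because they
    are created in [V]; so (a) applies.  Finally [[I,f]] is isomorphic to [f]. *)

(** * Lifting properties in a model category *)

Section RetractArgument.
Context {C : Category} (Q : ModelStructure C).

Lemma retract_of_first_factor (X Y Z : C) (f : hom X Y) (k : hom X Z) (p : hom Z Y) :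
  f = p ∘ k -> has_lift f p -> is_retract f k.
Proof.
move=> fE lift; have [|h [hf ph]] := lift k (idm Y); first by rewrite comp1m fE.
by exists (idm X), (idm X), h, p; rewrite !comp1m !compm1.
Qed.

Lemma retract_of_second_factor (X Y Z : C) (f : hom X Y) (k : hom X Z) (p : hom Z Y) :
  f = p ∘ k -> has_lift k f -> is_retract f p.
Proof.
move=> fE lift; have [|h [hk fh]] := lift (idm X) p; first by rewrite compm1 fE.
by exists k, h, (idm Y), (idm Y); rewrite !comp1m.
Qed.

(** This lemma and the next three are converses of the lifting axioms: factor the map
    so that it has the lifting property against one of its factors, and is therefore a
    retract of the other one. *)
Lemma cof_of_lift (K L : C) (i : hom K L) :
  (forall (X Y : C) (p : hom X Y), afib Q p -> has_lift i p) -> cof Q i.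
Proof.
move=> lift; have [Z [k [p [ck [fp [wp e]]]]]] := factor_cof_afib Q i.
exact: (cof_retract (retract_of_first_factor e (lift _ _ p (conj fp wp))) ck).
Qed.

Lemma acof_of_lift (K L : C) (i : hom K L) :
  (forall (X Y : C) (p : hom X Y), fib Q p -> has_lift i p) -> acof Q i.
Proof.
move=> lift; have [Z [k [p [ck [wk [fp e]]]]]] := factor_acof_fib Q i.
have r := retract_of_first_factor e (lift _ _ p fp).
by split; [apply: cof_retract r ck | apply: weq_retract r wk].
Qed.

Lemma fib_of_lift (X Y : C) (p : hom X Y) :
  (forall (K L : C) (i : hom K L), acof Q i -> has_lift i p) -> fib Q p.
Proof.
move=> lift; have [Z [k [q [ck [wk [fq e]]]]]] := factor_acof_fib Q p.
exact: (fib_retract (retract_of_second_factor e (lift _ _ k (conj ck wk))) fq).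
Qed.

Lemma afib_of_lift (X Y : C) (p : hom X Y) :
  (forall (K L : C) (i : hom K L), cof Q i -> has_lift i p) -> afib Q p.
Proof.
move=> lift; have [Z [k [q [ck [fq [wq e]]]]]] := factor_cof_afib Q p.
have r := retract_of_second_factor e (lift _ _ k ck).
by split; [apply: fib_retract r fq | apply: weq_retract r wq].
Qed.
End RetractArgument.

Lemma initial_ext {C : Category} (colims : HasFiniteColimits C) (X : C)
  (f g : hom (initial colims) X) : f = g.
Proof. by apply: colim_ext; case. Qed.

(** * Adjunctions and lifting *)

(** Naturality is required of [radj] alone; that of its inverse [ladj] follows. *)
Record Adjunction (C D : Category) (F : Functor C D) (G : Functor D C) := MkAdjunction {
  radj : forall (X : C) (Y : D), hom (F X) Y -> hom X (G Y);
  ladj : forall (X : C) (Y : D), hom X (G Y) -> hom (F X) Y;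
  radjK : forall (X : C) (Y : D) (f : hom (F X) Y), ladj (radj f) = f;
  ladjK : forall (X : C) (Y : D) (f : hom X (G Y)), radj (ladj f) = f;
  radj_pre : forall (X' X : C) (Y : D) (f : hom (F X) Y) (j : hom X' X),
    radj (f ∘ fmap F j) = radj f ∘ j;
  radj_post : forall (X : C) (Y Y' : D) (p : hom Y Y') (f : hom (F X) Y),
    radj (p ∘ f) = fmap G p ∘ radj f }.

Arguments radj {_ _ _ _} _ {_ _} _.
Arguments ladj {_ _ _ _} _ {_ _} _.

Section AdjunctionTheory.
Context {C D : Category} {F : Functor C D} {G : Functor D C} (a : Adjunction F G).

Lemma radj_inj (X : C) (Y : D) (f g : hom (F X) Y) : radj a f = radj a g -> f = g.
Proof. by move=> e; rewrite -(radjK a f) e radjK. Qed.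

Lemma has_lift_adj (K L : C) (X Y : D) (j : hom K L) (p : hom X Y) :
  has_lift (fmap F j) p <-> has_lift j (fmap G p).
Proof.
split=> lift u v e.
- have [|h [hj ph]] := lift (ladj a u) (ladj a v).
    by apply: radj_inj; rewrite radj_post radj_pre !ladjK.
  exists (radj a h); split; first by rewrite -radj_pre hj ladjK.
  by rewrite -radj_post ph ladjK.
- have [|h [hj ph]] := lift (radj a u) (radj a v).
    by rewrite -radj_post -radj_pre e.
  exists (ladj a h); split; apply: radj_inj; first by rewrite radj_pre ladjK.
  by rewrite radj_post ladjK.
Qed.

Context (QC : ModelStructure C) (QD : ModelStructure D).

Lemma left_cof_iff_right_afib :
  preserves_cofibrations QC QD F <-> preserves_acyclic_fibrations QD QC G.
Proof.
split=> pres X Y f hf.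
- apply: afib_of_lift => K L i ci; apply/has_lift_adj.
  by case: hf => ff wf; apply: lift_cof_afib ff wf; apply: pres.
- apply: cof_of_lift => Z W p ap; apply/has_lift_adj.
  by case: (pres _ _ _ ap) => fp wp; apply: lift_cof_afib fp wp.
Qed.

Lemma left_acof_iff_right_fib :
  preserves_acyclic_cofibrations QC QD F <-> preserves_fibrations QD QC G.
Proof.
split=> pres X Y f hf.
- apply: fib_of_lift => K L i ai; apply/has_lift_adj.
  by case: (pres _ _ _ ai) => ci wi; apply: lift_acof_fib ci wi hf.
- apply: acof_of_lift => Z W p fp; apply/has_lift_adj.
  by case: hf => cf wf; apply: lift_acof_fib cf wf _; apply: pres.
Qed.

Lemma left_initial_ext (cC : HasFiniteColimits C) (Y : D) (f g : hom (F (initial cC)) Y) :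
  f = g.
Proof. by apply: radj_inj; apply: initial_ext. Qed.

(** The two equivalences cross over: cofibrations on the left correspond to acyclic
    fibrations on the right. *)
Lemma quillen_left_iff_right :
  preserves_fibrations QD QC G /\ preserves_acyclic_fibrations QD QC G <->
  preserves_cofibrations QC QD F /\ preserves_acyclic_cofibrations QC QD F.
Proof.
rewrite left_cof_iff_right_afib left_acof_iff_right_fib.
by split=> - [].
Qed.
End AdjunctionTheory.

(** * Chosen pullbacks *)

Section PullbackTheory.
Context {C : Category} (lim : HasFiniteLimits C) {X Y Z : C} (f : hom X Z) (g : hom Y Z).

Lemma pb_square : f ∘ pb1 lim f g = g ∘ pb2 lim f g.
Proof.
have e1 := @cone_nat _ _ _ (pullback_limit lim f g) cs_left cs_mid tt.
have e2 := @cone_nat _ _ _ (pullback_limit lim f g) cs_right cs_mid tt.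
exact: (eq_trans e1 (eq_sym e2)).
Qed.

Lemma pb1_pair (W : C) (u : hom W X) (v : hom W Y) (e : f ∘ u = g ∘ v) :
  pb1 lim f g ∘ pb_pair lim e = u.
Proof. exact: (lim_liftE (pullback_limit lim f g) (cospan_cone e) cs_left). Qed.

Lemma pb2_pair (W : C) (u : hom W X) (v : hom W Y) (e : f ∘ u = g ∘ v) :
  pb2 lim f g ∘ pb_pair lim e = v.
Proof. exact: (lim_liftE (pullback_limit lim f g) (cospan_cone e) cs_right). Qed.

Lemma pb_ext (W : C) (u v : hom W (pullback lim f g)) :
  pb1 lim f g ∘ u = pb1 lim f g ∘ v -> pb2 lim f g ∘ u = pb2 lim f g ∘ v -> u = v.
Proof.
move=> e1 e2; apply: lim_ext; case; [exact: e1 | exact: e2 |].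
rewrite -(@cone_nat _ _ _ (pullback_limit lim f g) cs_left cs_mid tt) -!compA.
by congr (_ ∘ _).
Qed.
End PullbackTheory.

(** * Closed symmetric monoidal categories *)

Section SymMonTheory.
Context {C : Category} (S : ClosedSymMon C).
Local Notation "X ⊗ Y" := (tens S X Y) (at level 38, left associativity).
Local Notation "f ⊠ g" := (tmap S f g) (at level 38, left associativity).
Local Notation "1" := (idm _).
Local Notation I := (unit_ob S).

Lemma tens_unit_faithful_r {X Y : C} (f g : hom X Y) :
  f ⊠ idm I = g ⊠ idm I -> f = g.
Proof.
move=> /(f_equal (fun h => runit S Y ∘ h)); rewrite !runit_nat.
exact: (cancel_epi (runitVK S X)).
Qed.

(** The mirror image of [lunit_assoc]: the pentagon with two units on the right, whose
    other faces are triangles and naturality squares. *)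
Lemma runit_assoc (X Y : C) : (1 ⊠ runit S Y) ∘ assoc S X Y I = runit S (X ⊗ Y).
Proof.
apply: tens_unit_faithful_r; apply: (cancel_mono (assocK S X Y I)).
rewrite tmap_l compA assoc_nat -triangle tmap_r -!compA.
rewrite (compA (1 ⊠ assoc S Y I I)) -pentagon -triangle !compA.
by congr (_ ∘ _); rewrite -assoc_nat tmap1.
Qed.

Lemma runit_assocV (X Y : C) : runit S (X ⊗ Y) ∘ assocV S X Y I = 1 ⊠ runit S Y.
Proof. by rewrite -runit_assoc -compA assocVK compm1. Qed.

(** The next three lemmas are the naturality of transposition in each of its three
    variables. *)
Lemma curry_pre {X Y Z Z' : C} (f : hom (Z ⊗ X) Y) (k : hom Z' Z) :
  curry S f ∘ k = curry S (f ∘ (k ⊠ 1)).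
Proof. by apply: ihom_ext; rewrite tmap_l compA !curryK. Qed.

Lemma curry_post {X Y Y' Z : C} (g : hom Y Y') (f : hom (Z ⊗ X) Y) :
  ihom_map S X g ∘ curry S f = curry S (g ∘ f).
Proof. by apply: ihom_ext; rewrite tmap_l compA ev_map -compA !curryK. Qed.

Lemma curry_arg {X X' Y Z : C} (f : hom (Z ⊗ X) Y) (j : hom X' X) :
  ihom_pre S j Y ∘ curry S f = curry S (f ∘ (1 ⊠ j)).
Proof.
by apply: ihom_ext; rewrite tmap_l compA ev_pre -compA -tmap_swap compA !curryK.
Qed.

Lemma curry_inj {X Y Z : C} (f g : hom (Z ⊗ X) Y) : curry S f = curry S g -> f = g.
Proof. by move=> e; rewrite -(curryK f) e curryK. Qed.

(** Evaluation at the unit is an isomorphism [[I,X] ≅ X], natural in [X].  The weaker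
    conclusion suffices: fibrations and weak equivalences are closed under retracts. *)
Lemma ihom_unit_retract {X Y : C} (f : hom X Y) : is_retract (ihom_map S I f) f.
Proof.
have retr Z : curry S (runit S Z) ∘ (ev S I Z ∘ runitV S _) = 1.
  apply: ihom_ext; rewrite tmap1 compm1 curry_pre curryK runit_nat.
  by rewrite -compA runitK compm1.
exists (ev S I X ∘ runitV S _), (curry S (runit S X)),
  (ev S I Y ∘ runitV S _), (curry S (runit S Y)).
split; [exact: retr | split; [exact: retr | split]]; last first.
  by rewrite curry_post curry_pre runit_nat.
apply: (@cancel_epi _ _ _ _ (runit S _) (runitV S _)); first exact: runitVK.
rewrite -!compA runitK compm1 -ev_map -runit_nat.
by rewrite (compA (runitV S _)) runitK comp1m.
Qed.
End SymMonTheory.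

(** * Maps of modules in two variables *)

Section ModuleAdjunctions.
Context {C : Category} {S : ClosedSymMon C} (A : Monoid S).
Local Notation "X ⊗ Y" := (tens S X Y) (at level 38, left associativity).
Local Notation "f ⊠ g" := (tmap S f g) (at level 38, left associativity).
Local Notation "1" := (idm _).
Local Notation I := (unit_ob S).

(** The condition on [M ∧ X -> N] through which the module maps out of [M ∧ X], the
    maps into [^A[M,N]] and the module maps into [[X,N]] are compared.  It is phrased
    with [(A ∧ M) ∧ X] as source, so that only [assoc], and not [assocV], occurs. *)
Definition act_linear (M : Mod A) (X : C) (N : Mod A)
  (f : hom (mod_ob M ⊗ X) (mod_ob N)) : Prop :=
  f ∘ (act M ⊠ 1) = act N ∘ (1 ⊠ f) ∘ assoc S A (mod_ob M) X.

Lemma act_linearP (M : Mod A) (X : C) (N : Mod A) (f : hom (mod_ob M ⊗ X) (mod_ob N)) :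
  act_linear f <-> is_module_map (M := smash_module M X) (N := N) f.
Proof.
rewrite /act_linear /is_module_map /=; split=> e.
- by rewrite compA e -compA assocVK compm1.
- by rewrite -e compA -compA assocK compm1.
Qed.

Section SmashMap.
Variable lim : HasFiniteLimits C.

(** The map [A ∧ -] of function objects is defined by moving [A] past [[M,N]] with the
    symmetry.  After transposition the two maps of the equalizer thus become the two
    sides of [act_linear], composed with the symmetry of [X] and [A ∧ M]; the hexagon
    identifies that symmetry with the composite of the two smaller ones. *)
Lemma act_linear_equalizes (M : Mod A) (X : C) (N : Mod A)
  (f : hom (mod_ob M ⊗ X) (mod_ob N)) :
  let k := curry S (f ∘ braid S X (mod_ob M)) in
  act_linear f <-> map_source M N ∘ k = map_target M N ∘ k.
Proof.
move=> k.
have es : map_source M N ∘ k =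
    curry S (f ∘ (act M ⊠ 1) ∘ braid S X (A ⊗ mod_ob M)).
  by rewrite /map_source curry_arg -!compA braid_nat.
have et : map_target M N ∘ k =
    curry S (act N ∘ (1 ⊠ f) ∘ assoc S A (mod_ob M) X ∘ braid S X (A ⊗ mod_ob M)).
  rewrite /map_target -compA [ihom_smash _ _ _ _ ∘ k]curry_pre curry_post.
  congr (curry S _); rewrite -[idm (A ⊗ mod_ob M)]tmap1 -!compA assocV_nat.
  rewrite (compA (braid S _ _ ⊠ 1)) -tmap_l braid_nat tmap_l -!compA.
  rewrite (compA (assoc S _ _ _)) assoc_nat -!compA.
  rewrite (compA (1 ⊠ ev S _ _)) -tmap_r curryK tmap_r -!compA.
  rewrite (compA (assoc S A X _)) !(compA (1 ⊠ braid S _ _)).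
  by rewrite -hexagon -!compA assocVK compm1.
rewrite es et; split=> [-> //|] /curry_inj.
exact: (cancel_epi (braidK S _ _)).
Qed.

Definition to_map_ob (M : Mod A) (X : C) (N : Mod A) (f : hom (smash_module M X) N) :
  hom X (map_ob lim M N) :=
  eq_lift lim (proj1 (act_linear_equalizes _)
    (proj2 (act_linearP (proj1_sig f)) (proj2_sig f))).

Lemma map_incl_to_map_ob (M : Mod A) (X : C) (N : Mod A) (f : hom (smash_module M X) N) :
  map_incl lim M N ∘ to_map_ob f = curry S (proj1_sig f ∘ braid S X (mod_ob M)).
Proof. exact: eq_liftE. Qed.

Definition of_map_ob_map (M : Mod A) (X : C) (N : Mod A) (k : hom X (map_ob lim M N)) :
  hom (mod_ob M ⊗ X) (mod_ob N) :=
  ev S (mod_ob M) (mod_ob N) ∘ ((map_incl lim M N ∘ k) ⊠ 1) ∘ braid S (mod_ob M) X.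

Lemma curry_of_map_ob (M : Mod A) (X : C) (N : Mod A) (k : hom X (map_ob lim M N)) :
  curry S (of_map_ob_map k ∘ braid S X (mod_ob M)) = map_incl lim M N ∘ k.
Proof. by rewrite /of_map_ob_map -compA braidK compm1 curry_uniq. Qed.

Lemma of_map_ob_linear (M : Mod A) (X : C) (N : Mod A) (k : hom X (map_ob lim M N)) :
  is_module_map (M := smash_module M X) (N := N) (of_map_ob_map k).
Proof.
apply/act_linearP/act_linear_equalizes.
by rewrite curry_of_map_ob !compA eq_inclE.
Qed.

Definition of_map_ob (M : Mod A) (X : C) (N : Mod A) (k : hom X (map_ob lim M N)) :
  hom (smash_module M X) N := exist _ (of_map_ob_map k) (of_map_ob_linear k).

Lemma map_ob_ext (M N : Mod A) (X : C) (k k' : hom X (map_ob lim M N)) :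
  map_incl lim M N ∘ k = map_incl lim M N ∘ k' -> k = k'.
Proof. exact: eq_ext. Qed.

(** The universal property of the equalizer [^A[M,N]], read through
    [act_linear_equalizes]. *)
Definition smash_map_adjunction (M : Mod A) :
  Adjunction (smash_functor M) (map_functor lim M).
Proof.
refine (@MkAdjunction _ _ (smash_functor M) (map_functor lim M)
  (@to_map_ob M) (@of_map_ob M) _ _ _ _).
- move=> X N f; apply: modhom_ext; apply: (cancel_epi (braidK S _ _)).
  by apply: curry_inj; rewrite curry_of_map_ob map_incl_to_map_ob.
- by move=> X N k; apply: map_ob_ext; rewrite map_incl_to_map_ob curry_of_map_ob.
- move=> X' X N f j; apply: map_ob_ext; rewrite compA !map_incl_to_map_ob.
  by rewrite curry_pre /= -!compA braid_nat.
- move=> X N N' p f; apply: map_ob_ext; rewrite compA map_morE -compA.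
  by rewrite !map_incl_to_map_ob curry_post /= compA.
Defined.
End SmashMap.

(** * Free modules *)

Lemma free_map_linear (X : C) (N : Mod A) (g : hom X (mod_ob N)) :
  is_module_map (M := smash_module (regular_module A) X) (N := N)
    (act N ∘ ((1 : hom A A) ⊠ g)).
Proof.
apply/act_linearP; rewrite /act_linear /= tmap_r -!compA.
rewrite -assoc_nat tmap1 !compA act_mul -!compA.
by rewrite tmap_swap.
Qed.

(** A module map out of [A ∧ X] is determined by its restriction along the unit of [A]. *)
Definition free_adjunction : Adjunction (smash_functor (regular_module A)) (underlying A).
Proof.
refine (@MkAdjunction _ _ (smash_functor (regular_module A)) (underlying A)
  (fun X N f => proj1_sig f ∘ (mon_one A ⊠ 1) ∘ lunitV S X)
  (fun X N g => exist _ _ (free_map_linear g)) _ _ _ _).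
- move=> X N f; apply: modhom_ext; rewrite /= !tmap_r !compA -(proj2_sig f) /=.
  rewrite -!compA (compA (assocV S _ _ _)) assocV_nat -!compA.
  rewrite (compA (mon_mul A ⊠ 1)) -tmap_l mon_mul1r -triangle -!compA.
  by rewrite (compA (assoc S _ _ _)) assocVK comp1m -tmap_r lunitVK tmap1 compm1.
- move=> X N g /=; rewrite -!compA (compA (1 ⊠ g)) -tmap_swap !compA act_one.
  by rewrite lunit_nat -compA lunitVK compm1.
- move=> X' X N f j /=; rewrite -!compA (compA (1 ⊠ j)) -tmap_swap -!compA.
  congr (_ ∘ (_ ∘ _)); apply: (cancel_mono (lunitK S X)).
  by rewrite !compA lunitVK comp1m lunit_nat -compA lunitVK compm1.
- by move=> X N N' p f /=; rewrite !compA.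
Defined.

(** * Cotensors and pullbacks of modules *)

Definition cotensor_act (X : C) (N : Mod A) :
  hom (A ⊗ ihom S X (mod_ob N)) (ihom S X (mod_ob N)) :=
  curry S (act N ∘ (1 ⊠ ev S X (mod_ob N)) ∘ assoc S A (ihom S X (mod_ob N)) X).

Definition cotensor (X : C) (N : Mod A) : Mod A.
Proof.
refine (@MkLModule _ _ A (ihom S X (mod_ob N)) (cotensor_act X N) _ _).
- apply: ihom_ext; rewrite ![(_ ∘ _) ⊠ idm X]tmap_l.
  rewrite !(compA (ev S _ _)) curryK -!compA.
  rewrite (compA (assoc S A (ihom S X _) X)) !assoc_nat -!compA.
  rewrite !tmap1 (compA (1 ⊠ ev S _ _)) -tmap_r curryK !tmap_r -!compA.
  rewrite (compA (1 ⊠ assoc S _ _ _)) -pentagon (compA (1 ⊠ ev S _ _)) -tmap_swap.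
  rewrite (compA (1 ⊠ (1 ⊠ _))) -assoc_nat !compA act_mul.
  by rewrite tmap1.
- apply: ihom_ext; rewrite tmap_l compA curryK -!compA assoc_nat tmap1.
  rewrite (compA (1 ⊠ _)) -tmap_swap !compA act_one lunit_nat -!compA.
  by rewrite lunit_assoc.
Defined.

Lemma curry_linear (M : Mod A) (X : C) (N : Mod A) (f : hom (mod_ob M ⊗ X) (mod_ob N)) :
  act_linear f <-> is_module_map (M := M) (N := cotensor X N) (curry S f).
Proof.
have e : cotensor_act X N ∘ (1 ⊠ curry S f) =
    curry S (act N ∘ (1 ⊠ f) ∘ assoc S A (mod_ob M) X).
  by rewrite curry_pre -!compA assoc_nat (compA (1 ⊠ ev S _ _)) -tmap_r curryK.
by rewrite /is_module_map /= e curry_pre; split=> [-> //|/curry_inj].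
Qed.

Definition mcurry (M : Mod A) (X : C) (N : Mod A) (f : hom (smash_module M X) N) :
  hom M (cotensor X N) :=
  exist _ (curry S (proj1_sig f))
    (proj1 (curry_linear _) (proj2 (act_linearP _) (proj2_sig f))).

Lemma muncurry_linear (M : Mod A) (X : C) (N : Mod A) (k : hom M (cotensor X N)) :
  is_module_map (M := smash_module M X) (N := N)
    (ev S X (mod_ob N) ∘ (proj1_sig k ⊠ 1)).
Proof.
by apply/act_linearP/curry_linear; rewrite curry_uniq; apply: (proj2_sig k).
Qed.

Lemma mcurry_inj (M : Mod A) (X : C) (N : Mod A) (f g : hom (smash_module M X) N) :
  mcurry f = mcurry g -> f = g.
Proof.
by move=> e; apply: modhom_ext; apply: curry_inj (f_equal (@proj1_sig _ _) e).
Qed.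

Definition muncurry (M : Mod A) (X : C) (N : Mod A) (k : hom M (cotensor X N)) :
  hom (smash_module M X) N := exist _ _ (muncurry_linear k).

Lemma smash_pre_linear (M N : Mod A) (i : hom M N) (X : C) :
  is_module_map (M := smash_module M X) (N := smash_module N X) (proj1_sig i ⊠ idm X).
Proof.
rewrite /is_module_map /= compA -!tmap_l (proj2_sig i) -compA assocV_nat.
by rewrite tmap_l -compA.
Qed.

Definition smash_pre (M N : Mod A) (i : hom M N) (X : C) :
  hom (smash_module M X) (smash_module N X) := exist _ _ (smash_pre_linear i X).

(** The pullback of modules is built on the chosen pullback of the underlying objects,
    and not taken from the finite limits of the category of modules, so that the
    map of the enrichment axiom, [pullback_hom], is the underlying map of the module
    map [cotensor_gap] on the nose. *)
Section PullbackModule.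
Variables (lim : HasFiniteLimits C) (X Y Z : Mod A) (f : hom X Z) (g : hom Y Z).
Local Notation P := (pullback lim (proj1_sig f) (proj1_sig g)).
Local Notation p1 := (pb1 lim (proj1_sig f) (proj1_sig g)).
Local Notation p2 := (pb2 lim (proj1_sig f) (proj1_sig g)).

Lemma pullback_act_compat :
  proj1_sig f ∘ (act X ∘ (1 ⊠ p1)) = proj1_sig g ∘ (act Y ∘ (1 ⊠ p2)).
Proof.
by rewrite !compA (proj2_sig f) (proj2_sig g) -!compA -!tmap_r pb_square.
Qed.

Definition pullback_module : Mod A.
Proof.
refine (@MkLModule _ _ A P (pb_pair lim pullback_act_compat) _ _);
  apply: pb_ext; rewrite !compA ?pb1_pair ?pb2_pair -!compA.
- rewrite (compA (1 ⊠ p1) (1 ⊠ _)) -tmap_r pb1_pair tmap_r -!compA.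
  by rewrite -assoc_nat !compA act_mul tmap1 -!compA tmap_swap.
- rewrite (compA (1 ⊠ p2) (1 ⊠ _)) -tmap_r pb2_pair tmap_r -!compA.
  by rewrite -assoc_nat !compA act_mul tmap1 -!compA tmap_swap.
- by rewrite -tmap_swap compA act_one lunit_nat.
- by rewrite -tmap_swap compA act_one lunit_nat.
Defined.

Lemma pb_pair_linear (M : Mod A) (u : hom M X) (v : hom M Y)
  (e : proj1_sig f ∘ proj1_sig u = proj1_sig g ∘ proj1_sig v) :
  is_module_map (M := M) (N := pullback_module) (pb_pair lim e).
Proof.
rewrite /is_module_map /=; apply: pb_ext.
- rewrite !compA !pb1_pair -compA -tmap_r pb1_pair; exact: (proj2_sig u).
- rewrite !compA !pb2_pair -compA -tmap_r pb2_pair; exact: (proj2_sig v).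
Qed.
End PullbackModule.

Lemma ihom_map_linear (X : C) (M N : Mod A) (p : hom M N) :
  is_module_map (M := cotensor X M) (N := cotensor X N) (ihom_map S X (proj1_sig p)).
Proof.
apply/(curry_linear (M := cotensor X M)); rewrite /act_linear /= -compA curryK !compA.
by rewrite (proj2_sig p) tmap_r !compA.
Qed.

Lemma ihom_pre_linear (X X' : C) (j : hom X' X) (N : Mod A) :
  is_module_map (M := cotensor X N) (N := cotensor X' N) (ihom_pre S j (mod_ob N)).
Proof.
apply/(curry_linear (M := cotensor X N)); rewrite /act_linear /=.
rewrite -compA -tmap_swap compA curryK.
by rewrite tmap_r -!compA -assoc_nat tmap1.
Qed.

Definition cotensor_map (X : C) (M N : Mod A) (p : hom M N) :
  hom (cotensor X M) (cotensor X N) := exist _ _ (ihom_map_linear X p).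

Definition cotensor_pre (X X' : C) (j : hom X' X) (N : Mod A) :
  hom (cotensor X N) (cotensor X' N) := exist _ _ (ihom_pre_linear j N).

(** * Extending lifts along a map of modules *)

Section Gap.
Variables (lim : HasFiniteLimits C) (U W : C) (j : hom U W) (X Y : Mod A) (p : hom X Y).

Definition cotensor_gap :
  hom (cotensor W X) (pullback_module lim (cotensor_map U p) (cotensor_pre j Y)) :=
  exist _ (pullback_hom lim S j (proj1_sig p))
    (pb_pair_linear lim (f := cotensor_map U p) (g := cotensor_pre j Y)
       (u := cotensor_pre j X) (v := cotensor_map W p)
       (eq_sym (ihom_pre_map S j (proj1_sig p)))).

(** A square from [N ∧ j] to [p] transposes to a map [k] from [N] to the target of
    [cotensor_gap], and its lifts to factorizations of [k] through [cotensor_gap].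
    A lift over [M] is such a factorization of [k ∘ i], so it is the top side of a
    square from [i] to [cotensor_gap] with bottom side [k]. *)
Lemma smash_lift_extend (M N : Mod A) (i : hom M N) :
  has_lift i cotensor_gap ->
  has_lift (fmap (smash_functor M) j) p -> has_lift (fmap (smash_functor N) j) p.
Proof.
move=> lift_gap lift_M u v e.
have e1 : proj1_sig p ∘ proj1_sig u = proj1_sig v ∘ (1 ⊠ j).
  exact: (f_equal (@proj1_sig _ _) e).
have [|h0 [h0j ph0]] := lift_M (u ∘ smash_pre i U) (v ∘ smash_pre i W).
  by apply: modhom_ext; rewrite /= compA e1 -!compA tmap_swap.
have e2 : proj1_sig (cotensor_map U p) ∘ proj1_sig (mcurry u) =
    proj1_sig (cotensor_pre j Y) ∘ proj1_sig (mcurry v).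
  by rewrite /= curry_post curry_arg e1.
pose k : hom N (pullback_module lim (cotensor_map U p) (cotensor_pre j Y)) :=
  exist _ (pb_pair lim e2) (pb_pair_linear lim e2).
have square : cotensor_gap ∘ mcurry h0 = k ∘ i.
  apply: modhom_ext; apply: pb_ext; rewrite /= !compA ?pb1_pair ?pb2_pair.
    rewrite curry_arg curry_pre; congr (curry S _).
    exact: (f_equal (@proj1_sig _ _) h0j).
  rewrite curry_post curry_pre; congr (curry S _).
  exact: (f_equal (@proj1_sig _ _) ph0).
have [h [_ gh]] := lift_gap _ _ square.
have gh1 : pullback_hom lim S j (proj1_sig p) ∘ proj1_sig h = pb_pair lim e2.
  exact: (f_equal (@proj1_sig _ _) gh).
exists (muncurry h); split; apply: modhom_ext; apply: curry_inj.
- rewrite /= -curry_arg curry_uniq.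
  have := f_equal (fun x => pb1 lim _ _ ∘ x) gh1.
  by rewrite !compA !pb1_pair.
- rewrite /= -curry_post curry_uniq.
  have := f_equal (fun x => pb2 lim _ _ ∘ x) gh1.
  by rewrite !compA !pb2_pair.
Qed.
End Gap.

(** By transposition to the cotensor, maps out of [0 ∧ Z] are unique, so that the two
    triangles of a lifting problem commute for any diagonal. *)
Lemma initial_smash_lift (cA : HasFiniteColimits (Mod A)) (U W : C) (j : hom U W)
  (X Y : Mod A) (p : hom X Y) :
  has_lift (fmap (smash_functor (initial cA)) j) p.
Proof.
have ext Z (N : Mod A) (f g : hom (smash_module (initial cA) Z) N) : f = g.
  by apply: mcurry_inj; apply: initial_ext.
move=> u v e; exists (muncurry (from_initial cA (cotensor W X))).
by split; apply: ext.
Qed.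

Lemma unitor_linear (M : Mod A) :
  is_module_map (M := smash_module M I) (N := M) (runit S (mod_ob M)).
Proof.
by rewrite /is_module_map /= compA runit_nat -compA runit_assocV.
Qed.

Lemma unitorV_linear (M : Mod A) :
  is_module_map (M := M) (N := smash_module M I) (runitV S (mod_ob M)).
Proof.
apply: (cancel_mono (runitK S _)).
by rewrite compA runitVK comp1m compA unitor_linear -compA -tmap_r runitVK tmap1 compm1.
Qed.

(** The two maps are even isomorphic: [M ∧ I ≅ M], and [M ∧ 0] is initial because
    [M ∧ -] is a left adjoint. *)
Lemma from_initial_retract (lim : HasFiniteLimits C) (cC : HasFiniteColimits C)
  (cA : HasFiniteColimits (Mod A)) (M : Mod A) :
  is_retract (from_initial cA M) (fmap (smash_functor M) (from_initial cC I)).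
Proof.
pose a := smash_map_adjunction lim M.
have ext (N : Mod A) (f g : hom (smash_functor M (initial cC)) N) : f = g.
  exact: (left_initial_ext a).
exists (from_initial cA _), (ladj a (from_initial cC _)),
  (exist _ _ (unitorV_linear M)), (exist _ _ (unitor_linear M)).
split; first exact: initial_ext.
split; first by apply: modhom_ext; rewrite /= runitVK.
by split; [apply: initial_ext | apply: ext].
Qed.
End ModuleAdjunctions.

(** * Semicofibrant modules *)

Section Model.
Context {V : MonoidalModelCategory} {A : Monoid (mm_mon V)}.
Local Notation Q := (mm_model V).
Local Notation S := (mm_mon V).

Lemma semicofibrant_ob_unit : semicofibrant_ob (V := V) (unit_ob S).
Proof.
split=> X Y f; first exact: (fib_retract (ihom_unit_retract S f)).
move=> [ff wf]; have r := ihom_unit_retract S f.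
by split; [apply: fib_retract r ff | apply: weq_retract r wf].
Qed.

Context {QA : ModelStructure (Mod A)} (hQA : created Q QA).

Lemma created_fib (M N : Mod A) (p : hom M N) : fib QA p <-> fib Q (proj1_sig p).
Proof. exact: (proj1 (hQA p)). Qed.

Lemma created_weq (M N : Mod A) (p : hom M N) : weq QA p <-> weq Q (proj1_sig p).
Proof. exact: (proj2 (hQA p)). Qed.

Lemma semicofibrant_mod_iff_smash (M : Mod A) :
  semicofibrant_mod QA M <->
  preserves_cofibrations Q QA (smash_functor M) /\
  preserves_acyclic_cofibrations Q QA (smash_functor M).
Proof. exact: (quillen_left_iff_right (smash_map_adjunction (lims Q) M)). Qed.

(** The common part of the passage from [M] to [N] in (b) and in (c): lifts from [M ∧ j]
    exist for one reason when [M] is semicofibrant and for another when it is initial. *)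
Lemma semicofibrant_mod_extend (M N : Mod A) (i : hom M N) : cof QA i ->
  (forall (U W : V) (j : hom U W) (X Y : Mod A) (p : hom X Y),
     cof Q j -> fib QA p -> weq Q j \/ weq QA p ->
     has_lift (fmap (smash_functor M) j) p) ->
  semicofibrant_mod QA N.
Proof.
move=> ci lift_M.
have lift_N (U W : V) (j : hom U W) (X Y : Mod A) (p : hom X Y) :
    cof Q j -> fib QA p -> weq Q j \/ weq QA p ->
    has_lift (fmap (smash_functor N) j) p.
  move=> cj fp wjp.
  apply: (smash_lift_extend (lim := lims Q)) (lift_M _ _ j _ _ p cj fp wjp).
  have [fg wg] := mm_enr cj (proj1 (created_fib p) fp).
  apply: lift_cof_afib ci _ _; first by apply/created_fib; apply: fg.
  apply/created_weq; apply: wg.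
  by case: wjp => [wj | /created_weq wp]; [left | right].
apply/semicofibrant_mod_iff_smash; split=> U W j.
- by move=> cj; apply: cof_of_lift => X Y p [fp wp]; apply: lift_N => //; right.
- by move=> [cj wj]; apply: acof_of_lift => X Y p fp; apply: lift_N => //; left.
Qed.

Lemma semicofibrant_mod_cof (M N : Mod A) (i : hom M N) :
  semicofibrant_mod QA M -> cof QA i -> semicofibrant_mod QA N.
Proof.
move=> /semicofibrant_mod_iff_smash [pc pac] ci.
apply: (semicofibrant_mod_extend ci) => U W j X Y p cj fp [wj | wp].
- by have [cMj wMj] := pac _ _ _ (conj cj wj); apply: lift_acof_fib cMj wMj fp.
- exact: lift_cof_afib (pc _ _ _ cj) fp wp.
Qed.

Lemma semicofibrant_mod_cofibrant (M : Mod A) :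
  cofibrant QA M -> semicofibrant_mod QA M.
Proof.
move=> cM; apply: (semicofibrant_mod_extend cM) => U W j X Y p _ _ _.
exact: initial_smash_lift.
Qed.

Lemma cofibrant_semicofibrant_mod (M : Mod A) :
  cofibrant Q (unit_ob S) -> semicofibrant_mod QA M -> cofibrant QA M.
Proof.
move=> cI /semicofibrant_mod_iff_smash [pc _].
have r := from_initial_retract (lims Q) (colims Q) (colims QA) M.
exact: cof_retract r (pc _ _ _ cI).
Qed.

Lemma semicofibrant_mod_regular : semicofibrant_mod QA (regular_module A).
Proof.
apply/semicofibrant_mod_iff_smash; apply/(quillen_left_iff_right (free_adjunction A)).
split=> M N f; first by move/created_fib.
by move=> [/created_fib ff /created_weq wf].
Qed.
End Model.

Theorem proposition1p3 (V : MonoidalModelCategory) (A : Monoid (mm_mon V))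
  (QA : ModelStructure (Mod A)) (hQA : created (mm_model V) QA) :
  (* (a) *)
  (forall M : Mod A,
     semicofibrant_mod QA M <->
     preserves_cofibrations (mm_model V) QA (smash_functor M) /\
     preserves_acyclic_cofibrations (mm_model V) QA (smash_functor M)) /\
  (* (b) *)
  ((forall M : Mod A, cofibrant QA M -> semicofibrant_mod QA M) /\
   (cofibrant (mm_model V) (unit_ob (mm_mon V)) ->
    forall M : Mod A, semicofibrant_mod QA M <-> cofibrant QA M)) /\
  (* (c) *)
  (forall (M N : Mod A) (i : hom M N),
     semicofibrant_mod QA M -> cof QA i -> semicofibrant_mod QA N) /\
  (* (d) *)
  (semicofibrant_mod QA (regular_module A) /\
   semicofibrant_ob (V := V) (unit_ob (mm_mon V))).
Proof.
split; first exact: semicofibrant_mod_iff_smash.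
split.
  split; first exact: semicofibrant_mod_cofibrant hQA.
  move=> cI M; split; first exact: cofibrant_semicofibrant_mod.
  exact: (semicofibrant_mod_cofibrant hQA).
split; first exact: (semicofibrant_mod_cof hQA).
split; [exact: (semicofibrant_mod_regular hQA) | exact: semicofibrant_ob_unit].
Qed.
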